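(* Let $\mathbb{X}=\mathbb{R}^d$, $d\in\mathbb{N}$, let $\bm\theta_0\in\mathbb R^d$ and $\bm\alpha=(\alpha_1,\dots,\alpha_d)\in(0,1)^d$. Suppose that $Z_n\stackrel{p}{\to}\bm\theta_0$ as $n\to\infty$. Let $T_{P,\bm\alpha,n,k_n}=\mathbf q_{P,\bm\alpha}(\tilde Z^{(1)}_{\lfloor n/k_n\rfloor},\dots,\tilde Z^{(k_n)}_{\lfloor n/k_n\rfloor})$ be computed from the sample of size $n$ in which $l_n$ observations are contaminated. Then $T_{P,\bm\alpha,n,k_n}\stackrel{p}{\to}\bm\theta_0$ as $n\to\infty$, for any $l_n$ and any $k_n=o(n)$ such that $\lim_{n\to\infty}l_n/k_n=0$.
   Context: Univariate quantile: for $\alpha\in(0,1)$ and $\mathbf x\in\mathbb R^k$ with increasingly ordered components $\tilde x_1\le\dots\le\tilde x_k$, $q_\alpha(\mathbf x)=\frac12(\tilde x_{\lceil k\alpha\rceil}+\tilde x_{\lfloor k\alpha+1\rfloor})$. Component-wise quantile in $\mathbb R^d$: for $\mathbf x_1,\dots,\mathbf x_k\in\mathbb R^d$, the $j$-th component of $\mathbf q_{P,\bm\alpha}(\mathbf x_1,\dots,\mathbf x_k)$ is $q_{\alpha_j}$ of the $j$-th components of $\mathbf x_1,\dots,\mathbf x_k$. Estimators and contamination: for each $m$, $Z_m$ is an estimator of $\bm\theta_0$ obtained by applying a fixed map to $m$ i.i.d. (uncontaminated) observations; the convergence hypothesis concerns this uncontaminated estimator. In the sample of $n$ i.i.d. observations,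 $l_n$ observations are contaminated, i.e. replaced by arbitrary random variables (with arbitrary distributions and arbitrary dependence among themselves and with the other observations, at arbitrary positions). The resulting sample is divided into $k_n$ disjoint blocks of equal size $\lfloor n/k_n\rfloor$, and $\tilde Z^{(i)}_{\lfloor n/k_n\rfloor}$ is the estimator computed from block $i$ of the contaminated sample (if contamination makes it not uniquely defined, it may take any of the possible values). *)

(* Defs.v *)
From HB Require Import structures.
From mathcomp Require Import all_boot all_order all_algebra.
From mathcomp Require Import all_classical all_reals all_analysis.

Set Implicit Arguments.
Unset Strict Implicit.
Unset Printing Implicit Defensive.

Import Order.TTheory GRing.Theory Num.Theory.
Import numFieldNormedType.Exports.

Local Open Scope classical_set_scope.
Local Open Scope ring_scope.

(* The order statistics of s are numbered from 1, as in the usual formula for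
   the quantile: order_stat s 1 is the minimum and order_stat s (size s) the
   maximum. *)
Definition order_stat (R : realType) (s : seq R) (i : nat) : R :=
  nth 0 (sort <=%R s) i.-1.

(* For 0 < alpha < 1 and s nonempty, with k = size s, both the ceiling of
   k alpha and the floor of k alpha + 1 lie between 1 and k, so neither the
   absolute value nor the default of nth plays a role. *)
Definition quantile (R : realType) (alpha : R) (s : seq R) : R :=
  let k : R := (size s)%:R in
  2^-1 * (order_stat s `|Num.ceil (k * alpha)|%N
          + order_stat s `|Num.floor (k * alpha + 1)|%N).

Definition cw_quantile (R : realType) (d k : nat) (alpha : 'rV[R]_d)
    (x : 'I_k -> 'rV[R]_d) : 'rV[R]_d :=
  \row_j quantile (alpha 0 j) [seq x i 0 j | i : 'I_k].

(* The norm of 'rV[R]_d is the maximum norm; as all norms on R^d are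
   equivalent, the notion does not depend on this choice. *)
Definition cvg_in_probability (dO : measure_display) (O : measurableType dO)
    (R : realType) (P : probability O R) (V : normedModType R)
    (Z : nat -> O -> V) (x : V) : Prop :=
  forall eps : R, 0 < eps ->
    P [set w | eps < `|Z n w - x|] @[n --> \oo] --> 0%E.

Definition mutually_independent (dO dE : measure_display)
    (O : measurableType dO) (E : measurableType dE) (R : realType)
    (P : probability O R) (I : finType) (X : I -> {RV P >-> E}) : Prop :=
  forall (J : {set I}) (A : I -> set E), (forall i, measurable (A i)) ->
    P (\bigcap_(i in [set` J]) (X i @^-1` A i))
    = (\prod_(i in J) P (X i @^-1` A i))%E.

Definition iid (dO dE : measure_display)
    (O : measurableType dO) (E : measurableType dE) (R : realType)
    (P : probability O R) (mu : probability E R) (I : finType)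
    (X : I -> {RV P >-> E}) : Prop :=
  mutually_independent X /\
  (forall i (A : set E), measurable A -> distribution P (X i) A = mu A).

(* Main.v *)
Require Import Defs.
From HB Require Import structures.
From mathcomp Require Import all_boot all_order all_algebra.
From mathcomp Require Import all_classical all_reals all_analysis.
From mathcomp Require Import measurable_realfun lra.

Set Implicit Arguments.
Unset Strict Implicit.
Unset Printing Implicit Defensive.

Import Order.TTheory GRing.Theory Num.Theory.
Import numFieldNormedType.Exports.

Local Open Scope classical_set_scope.
Local Open Scope ring_scope.

(** A quantile has a positive breakdown point: for 0 < alpha < 1, both order
    statistics that are averaged in the alpha-quantile of k numbers have at
    least a fraction min(alpha, 1 - alpha) of the k numbers on either side of
    them, themselves included.  So the quantile can be farther than eps from
    theta only if at least min(alpha, 1 - alpha) k of the numbers are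
    ([quantile_far]).  With c > 0 a common lower bound of these margins over the
    coordinates, a deviation of the component-wise quantile by more than eps
    forces at least c k of the k block estimators to deviate by more than eps
    ([cw_quantile_far]).

    The blocks are disjoint, so l contaminated observations spoil at most l
    blocks ([card_hit_blocks]), and l <= (c / 2) k for large n.  Hence at least
    (c / 2) k of the estimators computed from the clean observations deviate.
    Each of them has the law of the estimator computed from n %/ k i.i.d.
    observations ([joint_law]), so each deviates with the same probability
    p (n %/ k), where p m is the probability that the estimator computed from m
    clean observations deviates.  Markov's inequality for the number of deviating blocks
    ([counting_markov]) bounds the probability of the event by
    p (n %/ k) / (c / 2).  As the number of spoiled blocks is bounded outcome by
    outcome, the contamination may depend on the sample in any way.  Finally
    n %/ k tends to infinity because k = o(n) ([cvg_block_size]), so the bound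
    tends to 0 by consistency of the estimator. *)

(** * Quantiles far from a point *)

(** Everything about order statistics goes through this reduction to counting:
    both the breakdown bound and the measurability of quantiles. *)
Lemma order_stat_le (R : realType) (s : seq R) (i : nat) (t : R) :
  (0 < i <= size s)%N ->
  (order_stat s i <= t) = (i <= count (fun x => x <= t)%R s)%N.
Proof.
move=> /andP[i_gt0 i_le].
have sorted_s : sorted <=%R (sort <=%R s) by exact: sort_le_sorted.
have count_s : count (fun x => x <= t) (sort <=%R s)
               = count (fun x => x <= t) s.
  by apply/permP; rewrite perm_sort.
rewrite /order_stat -count_s; apply/idP/idP => [|le_i].
  apply: contraTT; rewrite -ltnNge -ltNge => lt_i.
  apply: nth_count_gt => //.
  by rewrite size_sort !prednK//= i_le andbT -ltnS prednK.
by apply: nth_count_le => //; rewrite prednK.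
Qed.

(** If the i-th order statistic lies above theta + eps, so do the
    (size s) + 1 - i largest entries; if it lies below theta - eps, so do the i
    smallest ones. *)
Lemma order_stat_far (R : realType) (s : seq R) (i : nat) (theta eps : R) :
  (0 < i <= size s)%N -> eps < `|order_stat s i - theta| ->
  (minn i ((size s).+1 - i) <= count (fun x => eps < `|x - theta|)%R s)%N.
Proof.
move=> i_in; rewrite ltr_normr => /orP[above|below].
- have : ~~ (order_stat s i <= theta + eps) by rewrite -ltNge; lra.
  rewrite order_stat_le// -ltnNge => few_below.
  apply: leq_trans (geq_minr _ _) _.
  apply: (@leq_trans (count (predC (fun x => x <= theta + eps)%R) s)).
    rewrite leq_subLR -(count_predC (fun x => x <= theta + eps) s) -addSn.
    by rewrite leq_add2r.
  apply: sub_count => x /=; rewrite -ltNge => lt_x.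
  by apply: lt_le_trans (ler_norm _); lra.
- apply: leq_trans (geq_minl _ _) _.
  have : order_stat s i <= order_stat s i by [].
  rewrite order_stat_le// => /leq_trans; apply; apply: sub_count => x /= le_x.
  by rewrite -normrN; apply: lt_le_trans (ler_norm _); lra.
Qed.

(** All that is used of the ranks ceil (k alpha) and floor (k alpha + 1) in the
    definition of the quantile, so that both are treated together. *)
Definition quantile_rank (R : realType) (alpha : R) (k i : nat) : Prop :=
  (0 < i <= k)%N /\ k%:R * alpha <= i%:R <= k%:R * alpha + 1.

Lemma quantile_rank_ceil (R : realType) (alpha : R) (k : nat) :
  0 < alpha < 1 -> (0 < k)%N ->
  quantile_rank alpha k `|Num.ceil (k%:R * alpha)|%N.
Proof.
move=> /andP[alpha_gt0 alpha_lt1] k_gt0.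
have k_gt0R : 0 < k%:R :> R by rewrite ltr0n.
set x := k%:R * alpha.
have x_gt0 : 0 < x by rewrite mulr_gt0.
have x_lt : x < k%:R by rewrite gtr_pMr.
have /andP[lt_x le_x] := ceil_itv x.
have c_gt0 : 0 < Num.ceil x by rewrite ceil_gt0.
have absE : (`|Num.ceil x|%N)%:R = (Num.ceil x)%:~R :> R.
  by rewrite natr_absz gtr0_norm.
split.
  rewrite absz_gt0 gt_eqF//= -(ler_nat R) absE.
  rewrite -[k%:R]/(k%:Z%:~R) ler_int ceil_le_int.
  by apply: ltW.
rewrite absE -/x le_x/=; move: lt_x; rewrite intrB mulr1z; lra.
Qed.

Lemma quantile_rank_floor (R : realType) (alpha : R) (k : nat) :
  0 < alpha < 1 -> (0 < k)%N ->
  quantile_rank alpha k `|Num.floor (k%:R * alpha + 1)|%N.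
Proof.
move=> /andP[alpha_gt0 alpha_lt1] k_gt0.
have k_gt0R : 0 < k%:R :> R by rewrite ltr0n.
set x := k%:R * alpha.
have x_gt0 : 0 < x by rewrite mulr_gt0.
have x_lt : x < k%:R by rewrite gtr_pMr.
have /andP[le_x lt_x] := floor_itv (x + 1).
have f_gt0 : 0 < Num.floor (x + 1) by rewrite floor_gt0 lerDr ltW.
have absE : (`|Num.floor (x + 1)|%N)%:R = (Num.floor (x + 1))%:~R :> R.
  by rewrite natr_absz gtr0_norm.
split.
  rewrite absz_gt0 gt_eqF//= -ltnS -(ltr_nat R) absE -natr1.
  by apply: le_lt_trans le_x _; lra.
rewrite absE -/x le_x andbT; move: lt_x; rewrite intrD mulr1z; lra.
Qed.

Lemma order_stat_rank_far (R : realType) (alpha : R) (s : seq R) (i : nat)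
    (theta eps : R) :
  quantile_rank alpha (size s) i -> eps < `|order_stat s i - theta| ->
  Num.min alpha (1 - alpha) * (size s)%:R
    <= (count (fun x => eps < `|x - theta|)%R s)%:R.
Proof.
move=> [i_in /andP[i_ge i_le]] /(order_stat_far i_in).
rewrite -(ler_nat R); apply: le_trans.
have /andP[i_gt0 i_les] := i_in.
have s_ge0 : 0 <= (size s)%:R :> R by [].
have ge_l : Num.min alpha (1 - alpha) * (size s)%:R <= alpha * (size s)%:R.
  by rewrite ler_wpM2r// ge_min lexx.
have ge_r : Num.min alpha (1 - alpha) * (size s)%:R
    <= (1 - alpha) * (size s)%:R.
  by rewrite ler_wpM2r// ge_min lexx orbT.
rewrite /minn; case: ifP => _; first by lra.
by rewrite natrB ?(leq_trans i_les)// -natr1; lra.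
Qed.

(** The midpoint of two numbers within eps of theta is within eps of theta, so
    one of the two averaged order statistics is far from theta. *)
Lemma quantile_far (R : realType) (alpha : R) (s : seq R) (theta eps : R) :
  0 < alpha < 1 -> (0 < size s)%N -> eps < `|quantile alpha s - theta| ->
  Num.min alpha (1 - alpha) * (size s)%:R
    <= (count (fun x => eps < `|x - theta|)%R s)%:R.
Proof.
move=> alpha01 s_gt0; rewrite /quantile.
set a := order_stat s `|Num.ceil _|%N; set b := order_stat s _ => far.
suff : eps < `|a - theta| \/ eps < `|b - theta|.
  case; apply: order_stat_rank_far.
    exact: quantile_rank_ceil.
  exact: quantile_rank_floor.
apply/orP; apply: contraLR far; rewrite negb_or -!leNgt => /andP[].
by rewrite !ler_norml => /andP[? ?] /andP[? ?]; apply/andP; split; lra.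
Qed.

Lemma count_image (I : finType) (T : Type) (f : I -> T) (p : pred T) :
  count p [seq f i | i : I] = #|[set i | p (f i)]%SET|.
Proof.
rewrite count_map -sum1_count -sum1_card big_enum_cond.
by apply: eq_bigl => i; rewrite finset.inE.
Qed.

(** * Measurability of component-wise quantiles *)

Lemma card_indic (R : realType) (T : Type) (I : finType) (A : I -> set T)
    (w : T) :
  #|[set i | w \in A i]%SET|%:R = \sum_i \1_(A i) w :> R.
Proof.
rewrite -sum1_card natr_sum big_mkcond; apply: eq_bigr => i _.
by rewrite finset.inE indicE; case: (w \in A i).
Qed.

Lemma measurable_card_mem (R : realType) (dT : measure_display)
    (T : measurableType dT) (I : finType) (A : I -> set T) :
  (forall i, measurable (A i)) ->
  measurable_fun [set: T] (fun w => #|[set i | w \in A i]%SET|%:R : R).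
Proof.
move=> mA; under eq_fun do rewrite card_indic.
by apply: measurable_sum => i; exact: measurable_indic.
Qed.

(** The event that the i-th order statistic is at most t says that at least i
    of the random variables are at most t; the number of those is a sum of
    indicators. *)
Lemma measurable_order_stat (R : realType) (dT : measure_display)
    (T : measurableType dT) (I : finType) (i : nat) (Z : I -> T -> R) :
  (0 < i <= #|I|)%N -> (forall j, measurable_fun [set: T] (Z j)) ->
  measurable_fun [set: T] (fun w => order_stat [seq Z j w | j : I] i).
Proof.
move=> i_in mZ _; apply: (measurability _ (RGenOInfty.measurableE R)) => //.
move=> /= _ [_ [t ->] <-]; rewrite setTI preimage_itvoy.
pose A j := [set w | Z j w <= t].
have mA j : measurable (A j).
  by rewrite -[A j]setTI /A -preimage_itvNyc; exact: mZ.
have -> : [set w | t < order_stat [seq Z j w | j : I] i]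
        = ~` [set w | i%:R <= (#|[set j | w \in A j]%SET|%:R : R)].
  apply/seteqP; split=> w /=;
    rewrite ltNge order_stat_le ?size_image// count_image ler_nat;
    (have -> : [set j | Z j w <= t]%SET = [set j | w \in A j]%SET
       by apply/setP => j; rewrite !finset.inE;
         apply/idP/idP => [?|/set_mem//]; exact: mem_set);
    by move/negP.
apply: measurableC; rewrite -[X in measurable X]setTI.
rewrite -(preimage_itvcy (fun w => #|[set j | w \in A j]%SET|%:R : R)).
exact: (measurable_card_mem mA).
Qed.

Lemma measurable_quantile (R : realType) (dT : measure_display)
    (T : measurableType dT) (I : finType) (alpha : R) (Z : I -> T -> R) :
  0 < alpha < 1 -> (0 < #|I|)%N ->
  (forall j, measurable_fun [set: T] (Z j)) ->
  measurable_fun [set: T] (fun w => quantile alpha [seq Z j w | j : I]).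
Proof.
move=> alpha01 I_gt0 mZ; rewrite /quantile.
under eq_fun do rewrite size_image.
apply: measurable_funM => //; apply: measurable_funD.
  by apply: measurable_order_stat => //; have [] := quantile_rank_ceil alpha01 I_gt0.
by apply: measurable_order_stat => //; have [] := quantile_rank_floor alpha01 I_gt0.
Qed.

(** The norm is a maximum that starts from the default 0; with eps >= 0 this
    default alone cannot exceed eps, even in dimension 0. *)
Lemma rV_norm_gt (R : realType) (d : nat) (v : 'rV[R]_d) (eps : R) :
  0 <= eps -> eps < `|v| <-> exists j, eps < `|v 0 j|.
Proof.
move=> eps_ge0; have -> : `|v| = mx_norm v by [].
rewrite mx_normrE; split.
  move/bigmax_gtP => [|[[i j] _ /= far]]; first by rewrite ltNge eps_ge0.
  by exists j; rewrite -(ord1 i).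
by move=> [j far]; apply/bigmax_gtP; right; exists (0, j).
Qed.

Lemma measurable_far (R : realType) (dT : measure_display)
    (T : measurableType dT) (d : nat) (Z : T -> 'rV[R]_d) (theta : 'rV[R]_d)
    (eps : R) :
  0 <= eps -> (forall j, measurable_fun [set: T] (fun w => Z w 0 j)) ->
  measurable [set w | eps < `|Z w - theta|].
Proof.
move=> eps_ge0 mZ.
have -> : [set w | eps < `|Z w - theta|]
        = \bigcup_(j in [set: 'I_d]) [set w | eps < `|Z w 0 j - theta 0 j|].
  apply/seteqP; split=> w /=.
    by move/(rV_norm_gt _ eps_ge0) => [j]; rewrite !mxE; exists j.
  move=> [j _ /= far]; apply/(rV_norm_gt _ eps_ge0).
  by exists j; rewrite !mxE.
apply: fin_bigcup_measurable => // j _; rewrite -[X in measurable X]setTI.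
rewrite -(preimage_itvoy (fun w => `|Z w 0 j - theta 0 j|)).
have mfar : measurable_fun [set: T] (fun w => `|Z w 0 j - theta 0 j|).
  by apply: measurableT_comp => //; exact: measurable_funB.
exact: mfar.
Qed.

(** * Markov's inequality for a counting variable *)

(** Integrate over B the inequality between c and the number of events that
    occur, written as a sum of indicators. *)
Lemma counting_markov (R : realType) (dT : measure_display)
    (T : measurableType dT) (mu : {measure set T -> \bar R}) (I : finType)
    (A : I -> set T) (B : set T) (c : R) :
  (forall i, measurable (A i)) -> measurable B -> 0 <= c ->
  (forall w, B w -> c <= #|[set i | w \in A i]%SET|%:R) ->
  (c%:E * mu B <= \sum_i mu (A i))%E.
Proof.
move=> mA mB c_ge0 c_le; rewrite -(integral_cst _ mB).
apply: (@le_trans _ _ (\int[mu]_(x in B) \sum_i (\1_(A i) x)%:E)%E).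
  apply: ge0_le_integral => //=.
  - apply: emeasurable_sum => i; apply/measurable_EFinP.
    exact: measurable_indic.
  - by move=> w /c_le; rewrite card_indic sumEFin lee_fin.
rewrite ge0_integral_sum//.
- apply: lee_sum => i _; rewrite integral_indic//.
  by apply: le_measure; rewrite ?inE//; exact: measurableI.
- move=> i; apply/measurable_EFinP; exact: measurable_indic.
Qed.

(** * Law of an i.i.d. sample *)

(** A block of an i.i.d. sample is an i.i.d. sample of the size of the block. *)
Lemma iid_reindex (dO dE : measure_display) (O : measurableType dO)
    (E : measurableType dE) (R : realType) (P : probability O R)
    (mu : probability E R) (I J : finType) (X : I -> {RV P >-> E})
    (f : J -> I) :
  injective f -> iid mu X -> iid mu (fun j => X (f j)).
Proof.
move=> f_inj [indepX lawX]; split=> [K A mA|j]; last exact: lawX.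
(* The events are transported along f; indices outside the image of f get the
   sure event. *)
pose B i := if [pick j | f j == i] is Some j then A j else [set: E].
have Bf j : B (f j) = A j.
  rewrite /B; case: pickP => [j' /eqP/f_inj ->//|/(_ j)].
  by rewrite eqxx.
have mB i : measurable (B i) by rewrite /B; case: pickP.
have := indepX (f @: K)%SET B mB.
rewrite big_imset/=; last by move=> ? ? _ _ /f_inj.
under [X in _ = X -> _]eq_bigr do rewrite Bf.
move=> <-; congr (P _); apply/seteqP; split=> w Xw i /=.
  by move=> /imsetP[j Kj ->]; rewrite Bf; exact: Xw.
by move=> Ki; rewrite -Bf; apply: Xw => /=; exact: imset_f.
Qed.

Definition joint (dO dE : measure_display) (O : measurableType dO)
    (E : measurableType dE) (R : realType) (P : probability O R) (m : nat)
    (X : 'I_m -> {RV P >-> E}) (w : O) : m.-tuple E :=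
  [tuple X i w | i < m].

Lemma measurable_joint (dO dE : measure_display) (O : measurableType dO)
    (E : measurableType dE) (R : realType) (P : probability O R) (m : nat)
    (X : 'I_m -> {RV P >-> E}) :
  measurable_fun [set: O] (joint X).
Proof.
apply/measurable_fun_tnthP => i; rewrite (_ : _ \o _ = X i)//.
by apply/funext => w; rewrite /= tnth_mktuple.
Qed.

HB.instance Definition _ (dO dE : measure_display) (O : measurableType dO)
    (E : measurableType dE) (R : realType) (P : probability O R) (m : nat)
    (X : 'I_m -> {RV P >-> E}) :=
  isMeasurableFun.Build _ _ _ _ (joint X) (measurable_joint X).

Definition box (E : Type) (m : nat) (A : 'I_m -> set E) : set (m.-tuple E) :=
  [set x | forall i, A i (tnth x i)].

(** These rectangles form a pi-system that generates the product sigma-algebra,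
    on which the law of an i.i.d. sample is a product of marginals. *)
Definition boxes (dE : measure_display) (E : measurableType dE) (m : nat) :
    set (set (m.-tuple E)) :=
  [set box A | A in [set A : 'I_m -> set E | forall i, measurable (A i)]].

Lemma measurable_tuple_boxes (dE : measure_display) (E : measurableType dE)
    (m : nat) :
  @measurable _ (m.-tuple E) = <<s @boxes dE E m >>.
Proof.
apply/seteqP; split; apply: smallest_sub.
- exact: smallest_sigma_algebra.
- rewrite -bigcup_seq => _ [i _ [A mA <-]]; apply: sub_sigma_algebra.
  exists (fun j => if j == i then A else [set: E]) => [j|].
    by case: ifP.
  apply/seteqP; split=> [x /(_ i)|x [_ Ax] j]; first by rewrite eqxx setTI.
  by case: eqP => [->|].
- exact: sigma_algebra_measurable.
- move=> _ [A mA <-].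
  have -> : box A = \bigcap_(i in [set: 'I_m]) ((@tnth m E)^~ i @^-1` A i).
    by apply/seteqP; split=> x Ax i; [move=> _; exact: Ax | exact: (Ax i)].
  apply: fin_bigcap_measurable => // i _; rewrite -[X in measurable X]setTI.
  by apply: (@measurable_tnth _ E m i).
Qed.

Lemma boxes_setI (dE : measure_display) (E : measurableType dE) (m : nat) :
  setI_closed (@boxes dE E m).
Proof.
move=> _ _ [A mA <-] [B mB <-]; exists (fun i => A i `&` B i).
  by move=> i; exact: measurableI.
apply/seteqP; split=> x; first by move=> AB; split=> i; case: (AB i).
by move=> [Ax Bx] i; split.
Qed.

Lemma joint_box (dO dE : measure_display) (O : measurableType dO)
    (E : measurableType dE) (R : realType) (P : probability O R)
    (mu : probability E R) (m : nat) (X : 'I_m -> {RV P >-> E})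
    (A : 'I_m -> set E) :
  iid mu X -> (forall i, measurable (A i)) ->
  distribution P (joint X) (box A) = (\prod_i mu (A i))%E.
Proof.
move=> [indepX lawX] mA; have := indepX [set: 'I_m]%SET A mA.
under eq_bigr do rewrite -[P _]/(distribution P (X _) _) lawX//.
under eq_bigl do rewrite finset.inE.
move=> <-; congr (P _); apply/seteqP; split=> w /=.
  by move=> Xw i _; have := Xw i; rewrite tnth_mktuple.
by move=> Xw i; rewrite tnth_mktuple; apply: Xw; rewrite /= finset.inE.
Qed.

(** Two probability measures that agree on a generating pi-system are equal. *)
Lemma joint_law (dO dE : measure_display) (O : measurableType dO)
    (E : measurableType dE) (R : realType) (P : probability O R)
    (mu : probability E R) (m : nat) (X X' : 'I_m -> {RV P >-> E})
    (A : set (m.-tuple E)) :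
  iid mu X -> iid mu X' -> measurable A ->
  distribution P (joint X) A = distribution P (joint X') A.
Proof.
move=> iidX iidX'; apply: (measure_unique (@boxes dE E m) (fun=> setT)).
- exact: measurable_tuple_boxes.
- exact: boxes_setI.
- by move=> _; exists (fun=> setT) => //; apply/seteqP; split.
- by apply/seteqP; split=> // x _; exists 0%N.
- move=> _ [B mB <-].
  exact: etrans (joint_box iidX mB) (esym (joint_box iidX' mB)).
- by move=> _; rewrite /= /distribution /pushforward preimage_setT probability_setT ltry.
Qed.

(** * Deviation of the component-wise quantile *)

Lemma exists_quantile_margin (R : realType) (d : nat) (alpha : 'rV[R]_d) :
  (forall j, 0 < alpha 0 j < 1) ->
  exists2 c : R, 0 < c & forall j, c <= Num.min (alpha 0 j) (1 - alpha 0 j).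
Proof.
move=> alpha01.
exists (\big[Num.min/1]_j Num.min (alpha 0 j) (1 - alpha 0 j)).
  apply/lt_bigmin; rewrite ?ltr01// => j _.
  by have /andP[? ?] := alpha01 j; rewrite lt_min subr_gt0; apply/andP.
by move=> j; exact: bigmin_le_cond.
Qed.

(** Whichever coordinate of the quantile is far from that of theta, the blocks
    whose coordinate is far are far in norm, and c does not depend on the
    coordinate. *)
Lemma cw_quantile_far (R : realType) (d k : nat) (alpha : 'rV[R]_d)
    (x : 'I_k -> 'rV[R]_d) (theta : 'rV[R]_d) (eps c : R) :
  (forall j, 0 < alpha 0 j < 1) -> (0 < k)%N -> 0 <= eps ->
  (forall j, c <= Num.min (alpha 0 j) (1 - alpha 0 j)) ->
  eps < `|cw_quantile alpha x - theta| ->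
  c * k%:R <= #|[set i | eps < `|x i - theta|]%SET|%:R.
Proof.
move=> alpha01 k_gt0 eps_ge0 c_le /(rV_norm_gt _ eps_ge0)[j].
rewrite !mxE => /(quantile_far (alpha01 j)).
rewrite size_image card_ord count_image => /(_ k_gt0) far.
apply: (@le_trans _ _ (Num.min (alpha 0 j) (1 - alpha 0 j) * k%:R)).
  by rewrite ler_wpM2r.
apply: le_trans far _; rewrite ler_nat; apply: subset_leq_card.
apply/fintype.subsetP => i; rewrite !finset.inE => far_i.
by apply/(rV_norm_gt _ eps_ge0); exists j; rewrite !mxE.
Qed.

Lemma measurable_cw_quantile (R : realType) (dT : measure_display)
    (T : measurableType dT) (d k : nat) (alpha : 'rV[R]_d)
    (Z : 'I_k -> T -> 'rV[R]_d) (j : 'I_d) :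
  (forall j, 0 < alpha 0 j < 1) -> (0 < k)%N ->
  (forall i j, measurable_fun [set: T] (fun w => Z i w 0 j)) ->
  measurable_fun [set: T] (fun w => cw_quantile alpha (Z^~ w) 0 j).
Proof.
move=> alpha01 k_gt0 mZ; under eq_fun do rewrite mxE.
by apply: measurable_quantile; rewrite ?card_ord.
Qed.

(** * Disjoint blocks *)

(** A block that meets C is the block of some position in C, and distinct
    blocks use distinct positions. *)
Lemma card_hit_blocks (I J T : finType) (blk : I -> J -> T) (C : {set T}) :
  injective (fun ij : I * J => blk ij.1 ij.2) ->
  (#|[set i | [exists j, blk i j \in C]]%SET| <= #|C|)%N.
Proof.
move=> blk_inj; pose S := [set ij : I * J | blk ij.1 ij.2 \in C]%SET.
apply: (@leq_trans #|S|).
  apply: leq_trans (leq_imset_card fst S); apply: subset_leq_card.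
  apply/fintype.subsetP => i; rewrite finset.inE => /existsP[j Cij].
  by apply/imsetP; exists (i, j); rewrite ?finset.inE.
rewrite -(card_imset (mem S) blk_inj); apply: subset_leq_card.
by apply/fintype.subsetP => _ /imsetP[ij Sij ->]; move: Sij; rewrite finset.inE.
Qed.

Lemma cvg_block_size (R : realType) (k : nat -> nat) :
  (forall n, (0 < k n)%N) ->
  (fun n => (k n)%:R : R^o) =o_\oo (fun n => n%:R : R^o) ->
  (n %/ k n)%N @[n --> \oo] --> \oo.
Proof.
move=> k_gt0 /eqoP k_small; apply/cvgnyPge => M.
have M_gt0 : 0 < M.+1%:R^-1 :> R by rewrite invr_gt0.
apply: filterS (k_small _ M_gt0) => n /=.
rewrite !ger0_norm// mulrC ler_pdivlMr// -natrM ler_nat => le_n.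
rewrite leq_divRL// mulnC; apply: leq_trans le_n.
by rewrite leq_mul.
Qed.

Theorem proposition3p8 (R : realType) (d : nat) (d_gt0 : (0 < d)%N)
    (theta0 : 'rV[R]_d) (alpha : 'rV[R]_d)
    (alpha01 : forall j, 0 < alpha 0 j < 1)
    (* probability space, observation space and law of the observations *)
    (dO : measure_display) (O : measurableType dO) (P : probability O R)
    (dE : measure_display) (E : measurableType dE) (mu : probability E R)
    (* X n is the uncontaminated sample of size n *)
    (X : forall n : nat, 'I_n -> {RV P >-> E})
    (iidX : forall n, iid mu (X n))
    (* the estimator and, for each data set, its possible values *)
    (est : forall m : nat, m.-tuple E -> 'rV[R]_d)
    (measurable_est :
      forall m j, measurable_fun [set: m.-tuple E] (fun x => est m x 0 j))
    (possible : forall m : nat, m.-tuple E -> set 'rV[R]_d)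
    (possible_est : forall m (x : m.-tuple E), possible m x (est m x))
    (est_cvg :
      cvg_in_probability P
        (fun n w => est n [tuple X n i w | i < n]) theta0)
    (l k : nat -> nat)
    (k_gt0 : forall n, (0 < k n)%N)
    (k_small : (fun n => (k n)%:R : R^o) =o_\oo (fun n => n%:R : R^o))
    (lk_cvg : (l n)%:R / (k n)%:R @[n --> \oo] --> (0 : R))
    (* C n w is the set of contaminated positions, Y n the resulting sample *)
    (C : forall n : nat, O -> {set 'I_n})
    (card_C : forall n w, #|C n w| = l n)
    (Y : forall n : nat, 'I_n -> {RV P >-> E})
    (Y_clean : forall n i w, i \notin C n w -> Y n i w = X n i w)
    (* blk n i r is the position in the sample of the r-th element of block i *)
    (blk : forall n : nat, 'I_(k n) -> 'I_(n %/ k n) -> 'I_n)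
    (blk_inj : forall n,
      injective (fun ir : 'I_(k n) * 'I_(n %/ k n) => blk n ir.1 ir.2))
    (* Zt n i is the estimator computed from block i of the sample Y n *)
    (Zt : forall n : nat, 'I_(k n) -> O -> 'rV[R]_d)
    (measurable_Zt :
      forall n i j, measurable_fun [set: O] (fun w => Zt n i w 0 j))
    (Zt_possible : forall n i w,
      possible (n %/ k n)%N [tuple Y n (blk n i r) w | r < n %/ k n]
        (Zt n i w))
    (Zt_clean : forall n i w, (forall r, blk n i r \notin C n w) ->
      Zt n i w = est (n %/ k n)%N [tuple Y n (blk n i r) w | r < n %/ k n]) :
  cvg_in_probability P
    (fun n w => cw_quantile alpha (fun i => Zt n i w)) theta0.
Proof.
move=> eps eps_gt0; have eps_ge0 := ltW eps_gt0.
have [c c_gt0 c_le] := exists_quantile_margin alpha01.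
pose D m := [set x : m.-tuple E | eps < `|est m x - theta0|].
have mD m : measurable (D m).
  by apply: measurable_far => // j; exact: measurable_est.
pose p m := P (joint (X m) @^-1` D m).
have p_cvg : ((c / 2)^-1%:E * p (n %/ k n)%N)%E @[n --> \oo] --> 0%E.
  rewrite -[X in _ --> X](mule0 (c / 2)^-1%:E); apply: cvgeZl => //.
  have est_p : p n @[n --> \oo] --> 0%E by exact: est_cvg.
  exact: (cvg_comp _ _ (cvg_block_size k_gt0 k_small) est_p).
apply: (squeeze_cvge _ (cvg_cst 0%E) p_cvg).
have c2_gt0 : 0 < c / 2 by rewrite divr_gt0.
have /cvgr_le/(_ _ c2_gt0) := lk_cvg; apply: filterS => n.
have kR_gt0 : 0 < (k n)%:R :> R by rewrite ltr0n.
rewrite ler_pdivrMr// => l_le; rewrite measure_ge0/=.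
set B := [set w | _].
have mB : measurable B.
  apply: measurable_far => // j.
  apply: (measurable_cw_quantile _ alpha01) => //; exact: measurable_Zt.
(* XB i is block i of the clean sample, and A i the event that the estimator
   computed from it deviates. *)
pose XB i r := X n (blk n i r).
pose A i := joint (XB i) @^-1` D (n %/ k n)%N.
have mA i : measurable (A i).
  by rewrite -[A i]setTI; apply: measurable_joint => //; exact: mD.
have PA i : P (A i) = p (n %/ k n)%N.
  apply: (joint_law (mu := mu)) => //.
  apply: iid_reindex => // r r' eq_blk.
  by case: (blk_inj n (i, r) (i, r') eq_blk).
(* At least c k blocks deviate, at most l <= (c / 2) k are hit by the
   contamination, and a block that is not hit sees the clean observations. *)
have many w : B w -> c / 2 * (k n)%:R <= #|[set i | w \in A i]%SET|%:R.
  move=> /(cw_quantile_far alpha01 (k_gt0 n) eps_ge0 c_le) far.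
  pose hit := [set i | [exists r, blk n i r \in C n w]]%SET.
  have hit_le : (#|hit| <= l n)%N.
    by rewrite -(card_C n w); exact: card_hit_blocks (@blk_inj n).
  have : (#|[set i | (eps < `|Zt n i w - theta0|)%R]%SET|
          <= #|hit| + #|[set i | w \in A i]%SET|)%N.
    apply: leq_trans (leq_card_setU _ _); apply: subset_leq_card.
    apply/fintype.subsetP => i; rewrite !finset.inE => far_i.
    case: (boolP [exists r, _]) => //= /existsPn clean.
    apply: mem_set; rewrite /A /D /=; move: far_i; rewrite Zt_clean//.
    congr (_ < `|est _ _ - _|); apply: eq_from_tnth => r.
    by rewrite !tnth_mktuple Y_clean.
  rewrite -(ler_nat R) natrD; move: hit_le; rewrite -(ler_nat R); lra.
have : ((c / 2 * (k n)%:R)%:E * P B <= \sum_(i < k n) p (n %/ k n)%N)%E.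
  rewrite -(eq_bigr _ (fun i _ => PA i)); apply: counting_markov => //.
  exact: ltW (mulr_gt0 c2_gt0 kR_gt0).
have pE : p (n %/ k n)%N = (fine (p (n %/ k n)%N))%:E.
  rewrite fineK// fin_num_measure// -[_ @^-1` _]setTI.
  by apply: measurable_joint => //; exact: mD.
have BE : P B = (fine (P B))%:E by rewrite fineK// fin_num_measure.
rewrite pE BE sumEFin sumr_const card_ord !lee_fin -[fine _ *+ _]mulr_natr.
by rewrite mulrAC ler_pM2r// ler_pdivlMl.
Qed.
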